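(* Let $n\ge 1$ be an integer, let $T$ be a group automorphism of $\mathbb{Z}_n$, and let $X=\mathrm{Al}(\mathbb{Z}_n,T)$ be the corresponding linear Alexander quandle, with $m$ orbits. Then the second quandle homology group of $X$ is $$H_2^Q(X)\cong \mathbb{Z}^{(m-1)m}\oplus\left(\mathbb{Z}/d\mathbb{Z}\right)^m,\qquad d=\gcd\left(m,\frac{n}{m}\right).$$
   Context: $\mathbb{Z}_n=\mathbb{Z}/n\mathbb{Z}$. The linear Alexander quandle $\mathrm{Al}(\mathbb{Z}_n,T)$ is the set $\mathbb{Z}_n$ with the operation $a\lhd b=Ta+(1-T)b$. The orbits of $X$ are the orbits under the group generated by the right translations $a\mapsto a\lhd c$, $c\in X$; they are the cosets of $\mathrm{Im}(1-T)=m\mathbb{Z}_n$, where $m$ is the number of orbits, so that $m$ divides $n$. The second quandle homology group is $H_2^Q(X)=\ker\partial_2/\mathrm{Im}\,\partial_3$ for the complex $C_3\xrightarrow{\partial_3}C_2\xrightarrow{\partial_2}C_1$, where $C_1=\mathbb{Z}[X]$, $C_2$ is the quotient of $\mathbb{Z}[X^2]$ by the span of the pairs $(x,x)$, $C_3$ is the quotient of $\mathbb{Z}[X^3]$ by the span of the triples $(x,y,z)$ with $x=y$ or $y=z$, and $\partial_2(x,y)=(x)-(x\lhd y)$, $\partial_3(x,y,z)=(x,z)-(x\lhd y,z)-(x,y)+(x\lhd z,y\lhd z)$. *)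

(* Defs.v *)
From HB Require Import structures.
From mathcomp Require Import all_boot all_order all_algebra all_fingroup.
From mathcomp Require Import generic_quotient boolp.

Set Implicit Arguments.
Unset Strict Implicit.
Unset Printing Implicit Defensive.

Import GRing.Theory.
Local Open Scope ring_scope.
Local Open Scope quotient_scope.

(* Z/nZ for n >= 1.  Unlike 'Z_n this is also correct for n = 1; it is not
   meant to be used with n = 0. *)
Notation Zmodn n := 'I_n.-1.+1 (only parsing).

Definition zmod_isog (U V : zmodType) : Prop :=
  exists f : {additive U -> V}, bijective f.

Section Subgroups.
Variables (U V W : zmodType).

(* Membership in the image is made boolean classically. *)
Definition im_pred (f : {additive U -> V}) : V -> bool :=
  fun v => `[< exists u, f u = v >].

Lemma im_zmod_closed f : zmod_closed (im_pred f).
Proof.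
split=> [|_ _ /asboolP[u <-] /asboolP[v <-]]; apply/asboolP.
  by exists 0; rewrite raddf0.
by exists (u - v); rewrite raddfB.
Qed.
HB.instance Definition _ f :=
  GRing.isZmodClosed.Build V (im_pred f) (im_zmod_closed f).

Definition ker_pred (g : {additive V -> W}) : V -> bool := fun v => g v == 0.

Lemma ker_zmod_closed g : zmod_closed (ker_pred g).
Proof.
split=> [|u v]; rewrite !unfold_in; first by rewrite raddf0.
by move=> /eqP gu /eqP gv; rewrite raddfB gu gv subrr.
Qed.
HB.instance Definition _ g :=
  GRing.isZmodClosed.Build V (ker_pred g) (ker_zmod_closed g).

Record ker (g : {additive V -> W}) := Ker {
  ker_val :> V;
  _ : ker_pred g ker_val }.

HB.instance Definition _ g := [isSub for @ker_val g].
HB.instance Definition _ g := [Choice of ker g by <:].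
HB.instance Definition _ g := [SubChoice_isSubZmodule of ker g by <:].

End Subgroups.

(* ker g / im f.  The composite g \o f is not required to vanish here; it does
   in the only use below, by [bnd2_bnd3]. *)
Section Homology.
Variables (U V W : zmodType) (f : {additive U -> V}) (g : {additive V -> W}).

Definition boundary_pred : ker g -> bool := fun z => im_pred f (val z).

Lemma boundary_zmod_closed : zmod_closed boundary_pred.
Proof.
have [im0 imB] := im_zmod_closed f.
by split=> [|u v /imB fu /fu]; rewrite unfold_in /= /boundary_pred ?raddf0 ?raddfB.
Qed.
HB.instance Definition _ :=
  GRing.isZmodClosed.Build (ker g) boundary_pred boundary_zmod_closed.

Definition homology : zmodType :=
  Quotient.quot (GRing.ZmodClosed.clone (ker g) boundary_pred _).

End Homology.

Section QuotientLift.
Variables (V W : zmodType) (I : zmodClosed V) (f : {additive V -> W}).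

Definition quot_lift (_ : forall v, v \in I -> f v = 0)
  (q : Quotient.quot I) : W := f (repr q).

Hypothesis f_kills_I : forall v, v \in I -> f v = 0.

Lemma quot_liftE v : quot_lift f_kills_I (\pi v) = f v.
Proof.
apply/eqP; rewrite -subr_eq0 -raddfB; apply/eqP; apply: f_kills_I.
by rewrite Quotient.idealrBE reprK.
Qed.

Lemma quot_lift_zmod_morphism : zmod_morphism (quot_lift f_kills_I).
Proof.
move=> p q; rewrite -[p]reprK -[q]reprK -raddfB !quot_liftE.
exact: raddfB.
Qed.
HB.instance Definition _ := GRing.isZmodMorphism.Build (Quotient.quot I) W
  (quot_lift f_kills_I) quot_lift_zmod_morphism.

End QuotientLift.

(* The free abelian group on a finite type: every function has finite
   support. *)
Notation freeZ I := {ffun I -> int}.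

Section FreeAbelian.
Variables (I : finType) (V : zmodType).

Definition gen (i : I) : freeZ I := [ffun j => (j == i)%:Z].

Definition linext (g : I -> V) (c : freeZ I) : V := \sum_i g i *~ c i.

Lemma linext_zmod_morphism g : zmod_morphism (linext g).
Proof.
move=> c d; rewrite /linext -sumrB; apply: eq_bigr => i _.
by rewrite !ffunE mulrzBr.
Qed.
HB.instance Definition _ g := GRing.isZmodMorphism.Build (freeZ I) V
  (linext g) (linext_zmod_morphism g).

Lemma linext_gen g i : linext g (gen i) = g i.
Proof.
rewrite /linext (bigD1 i) //= ffunE eqxx mulr1z big1 ?addr0 // => j.
by rewrite ffunE => /negbTE->; rewrite mulr0z.
Qed.

Definition span (g : I -> V) : zmodClosed V :=
  GRing.ZmodClosed.clone V (im_pred (linext g)) _.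

Lemma mem_span g i : g i \in span g.
Proof. by apply/asboolP; exists (gen i); exact: linext_gen. Qed.

Lemma span_kill (W : zmodType) (f : {additive V -> W}) g :
  (forall i, f (g i) = 0) -> forall v, v \in span g -> f v = 0.
Proof.
move=> fg _ /asboolP[c <-]; rewrite /= /linext raddf_sum big1 // => i _.
by rewrite raddfMz fg mul0rz.
Qed.

End FreeAbelian.

Record finQuandle := FinQuandle {
  quandle_sort :> finType;
  qop : quandle_sort -> quandle_sort -> quandle_sort;
  qopxx : forall x, qop x x = x;
  qop_bij : forall y, bijective (qop ^~ y);
  qop_dist : forall x y z, qop (qop x y) z = qop (qop x z) (qop y z) }.

Declare Scope quandle_scope.
Delimit Scope quandle_scope with quandle.
Notation "x ◁ y" := (qop x y)
  (at level 50, left associativity) : quandle_scope.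
Local Open Scope quandle_scope.

Section Orbits.
Variable X : finQuandle.

Definition rtrans (c : X) : {perm X} := perm (bij_inj (qop_bij c)).

Definition inner_group : {group {perm X}} := <<[set rtrans c | c : X]>>%G.

Definition quandle_orbits : {set {set X}} :=
  [set orbit 'P inner_group x | x : X].

End Orbits.

Section QuandleHomology.
Variable X : finQuandle.

Definition degen2 : zmodClosed (freeZ (X * X)%type) :=
  span (fun x : X => gen (x, x)).

Definition degen3 : zmodClosed (freeZ (X * X * X)%type) :=
  span (fun t : {t : X * X * X | (t.1.1 == t.1.2) || (t.1.2 == t.2)} =>
    gen (val t)).

Definition chain1 : zmodType := freeZ X.
Definition chain2 : zmodType := Quotient.quot degen2.
Definition chain3 : zmodType := Quotient.quot degen3.

Definition gen2 (x y : X) : chain2 := \pi_(Quotient.quot degen2) (gen (x, y)).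
Definition gen3 (x y z : X) : chain3 := \pi_(Quotient.quot degen3) (gen (x, y, z)).

Lemma gen2xx x : gen2 x x = 0.
Proof.
rewrite /gen2 -[0](raddf0 (\pi_(Quotient.quot degen2))).
apply/eqP; rewrite -Quotient.idealrBE subr0.
exact: (mem_span (fun x : X => gen (x, x))).
Qed.

Definition pre_bnd2 : {additive freeZ (X * X)%type -> chain1} :=
  linext (fun p => gen p.1 - gen (p.1 ◁ p.2)).

Definition pre_bnd3 : {additive freeZ (X * X * X)%type -> chain2} :=
  linext (fun t => let: (x, y, z) := t in
    gen2 x z - gen2 (x ◁ y) z - gen2 x y + gen2 (x ◁ z) (y ◁ z)).

Lemma pre_bnd2_degen v : v \in degen2 -> pre_bnd2 v = 0.
Proof.
by apply: span_kill => x; rewrite [pre_bnd2 _]linext_gen /= qopxx subrr.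
Qed.

Lemma pre_bnd3_degen v : v \in degen3 -> pre_bnd3 v = 0.
Proof.
apply: span_kill => -[[[x y] z] /= xyz]; rewrite [pre_bnd3 _]linext_gen /=.
case/orP: xyz => /= /eqP->; first by rewrite !qopxx !gen2xx subrr sub0r addNr.
by rewrite qopxx [_ - _ - _]addrAC subrr add0r addNr.
Qed.

Definition bnd2 : {additive chain2 -> chain1} := quot_lift pre_bnd2_degen.
Definition bnd3 : {additive chain3 -> chain2} := quot_lift pre_bnd3_degen.

Lemma bnd2E x y : bnd2 (gen2 x y) = gen x - gen (x ◁ y).
Proof. by rewrite [LHS]quot_liftE [LHS]linext_gen. Qed.

Lemma bnd3E x y z : bnd3 (gen3 x y z) =
  gen2 x z - gen2 (x ◁ y) z - gen2 x y + gen2 (x ◁ z) (y ◁ z).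
Proof. by rewrite [LHS]quot_liftE [LHS]linext_gen. Qed.

Lemma bnd2_bnd3 c : bnd2 (bnd3 c) = 0.
Proof.
rewrite -[c]reprK [bnd3 _]quot_liftE (raddf_sum bnd2) big1 //.
move=> [[x y] z] _; rewrite raddfMz raddfD !raddfB !bnd2E qop_dist.
set a := gen x; set b := gen (x ◁ z); set d := gen (x ◁ y); set e := gen _.
rewrite (_ : _ + _ = 0) ?mul0rz //.
rewrite (opprB d e) [e - d]addrC (addrACA a) [_ - (a - d)]addrAC subrr add0r.
by rewrite addrACA addNr subrr addr0.
Qed.

Definition quandle_H2 : zmodType := homology bnd3 bnd2.

End QuandleHomology.

Section LinearAlexander.
Variables (n : nat) (T : {additive Zmodn n -> Zmodn n}).
Hypothesis T_bij : bijective T.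

Definition alexander_op (a b : Zmodn n) : Zmodn n := T a + (b - T b).

Lemma alexander_opxx a : alexander_op a a = a.
Proof. by rewrite /alexander_op addrC subrK. Qed.

Lemma alexander_op_bij b : bijective (alexander_op ^~ b).
Proof.
case: T_bij => T' TK T'K; exists (fun a => T' (a - (b - T b))) => a.
  by rewrite /alexander_op addrK TK.
by rewrite /alexander_op T'K subrK.
Qed.

Lemma alexander_op_dist a b c :
  alexander_op (alexander_op a b) c =
  alexander_op (alexander_op a c) (alexander_op b c).
Proof.
rewrite /alexander_op 3!raddfD raddfB /=.
set r := T (T b); set e := _ - _; set k := c - _.
rewrite opprD [_ + k + _]addrA [RHS]addrACA subrr addr0.
by rewrite -addrA; congr (_ + _); rewrite addrAC.
Qed.

Definition alexander : finQuandle :=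
  FinQuandle alexander_opxx alexander_op_bij alexander_op_dist.

End LinearAlexander.

(* Main.v *)
Require Import Defs.
From HB Require Import structures.
From mathcomp Require Import all_boot all_order all_algebra all_fingroup.
From mathcomp Require Import generic_quotient boolp.
From mathcomp Require Import zify ring.

Set Implicit Arguments.
Unset Strict Implicit.
Unset Printing Implicit Defensive.

Import GRing.Theory Num.Theory.

(** Write [S] for [1 - T], so that [x ◁ y = x + S (y - x)].  The quotient of
    [chain2] by the boundaries is the abelian group [edge_group] generated by
    the edges [x -> x + S u], one for each [x] and [u], written [E x u].  The
    second homology is the subgroup of its cycles, that is, the first homology
    of a 2-complex whose components are the orbits.

    The boundary relations say that the moves [u], seen as operators on paths,
    satisfy [tau u * tau (v - S u) = tau v * tau (u - S u)].  Conjugation by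
    [tau u] is therefore additive in [u] ([conj_tauD]).  The group Z/nZ is
    cyclic, generated by 1, and [tau 1] commutes with itself, so all moves
    commute ([tau_commute]); it follows that [tau] is multiplicative as soon as
    one factor lies in the image of [S], which is mZ/nZ ([tau_addS]).

    Put [N = n / m].  A move [u = k + m * q], with [0 <= k < m], is thus a move
    [k] followed by a move [m * q], so that an edge has, in the orbit where it
    lies, two invariants: the value [k], counted by an integer if [k != 0], and
    [q] modulo [N] ([edge_invar]).  They extend to an additive map [invar] into
    a copy of Z^(m-1) x Z/N for each orbit.  A point of an orbit is determined
    by a coordinate in Z/N which each edge increases by [u = k + m * q];
    hence on cycles the total [sum k * c_k + m * q] vanishes in Z/N
    ([disp_cycle]).  Conversely all values in the kernel of this total
    displacement [disp] come from cycles ([cycle_realize]), by closing up edges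
    with paths made of moves 1.  Finally [invar] is injective on cycles
    ([invar_inj]): modulo the moves 1 an edge depends only on its orbit and its
    invariants, so a cycle without invariants is a combination of moves 1, and
    such a cycle goes equally often through all the moves 1 of an orbit; their
    number being zero, it vanishes.  (If [m = 1], the moves 1 are not counted,
    but then [S] is bijective and edges are differences of a potential.)

    It remains to identify the kernel of [disp] in each orbit.  If
    [d = gcd (m, N)], the number [c_1] may be traded for the integer
    [(sum k * c_k) / d], which is free, and what is left of [q] is an
    [N / d]-multiple in Z/N, that is, an element of Z/d ([theta_image]). *)

(** * Commutation of the moves *)

Section TwistedConjugation.
Local Open Scope group_scope.
Variables (U : zmodType) (S : {additive U -> U}) (G : groupType) (tau : U -> G).
Hypothesis tau0 : tau 0%R = 1.
Hypothesis tauS : forall u v,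
  tau u * tau (v - S u)%R = tau v * tau (u - S u)%R.

(** The relation with [v = 0] computes [tau (u - S u)]; after that, it says that
    subtracting [S u] from the argument amounts to conjugating by [tau u]. *)
Lemma tau_split u v : tau (v - S u)%R = tau v ^ tau u * tau (- S u)%R.
Proof.
have -> : tau (- S u)%R = (tau u)^-1 * tau (u - S u)%R.
  by rewrite -[X in _ * X]mul1g -tau0 -tauS add0r mulKg.
by rewrite conjgE -!mulgA mulKVg -tauS mulKg.
Qed.

(** Compute [tau (v - S (u + u'))] by subtracting [S (u + u')] at once or in two
    steps: [tau_split] gives two values for it, and comparing them with the
    same computation at [v = 0] cancels everything except the conjugates of
    [tau v]. *)
Lemma conj_tauD u u' v : tau v ^ tau (u + u')%R = (tau v ^ tau u) ^ tau u'.
Proof.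
apply: (mulIg (tau (- S (u + u'))%R)); rewrite -tau_split.
have split0 : tau (- S (u + u'))%R = tau (- S u)%R ^ tau u' * tau (- S u')%R.
  by rewrite -tau_split raddfD opprD.
by rewrite split0 mulgA -conjMg -tau_split -tau_split raddfD opprD addrA.
Qed.

Variable e : U.
Hypothesis e_gen : forall u, exists i, u = (e *+ i)%R.

(** Conjugation by [tau (e *+ i)] is the [i]-th iterate of conjugation by [tau e].
    So everything commutes with [tau e], because [tau e] does, and then with
    all the [tau (e *+ i)]. *)
Lemma tau_commute u v : tau u * tau v = tau v * tau u.
Proof.
have fixe i w : tau w ^ tau e = tau w -> tau w ^ tau (e *+ i)%R = tau w.
  move=> we; elim: i => [|i IHi]; first by rewrite mulr0n tau0 conjg1.
  by rewrite mulrSr conj_tauD IHi.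
have ee w : tau e ^ tau w = tau e.
  by have [i ->] := e_gen w; apply: fixe; rewrite conjgE mulKg.
have we w : tau w ^ tau e = tau w.
  by rewrite conjgE -{2}(ee w) -conjgC mulKg.
by have [i ->] := e_gen u; rewrite [RHS]conjgC fixe ?we.
Qed.

Lemma tau_addS u v : tau (v - S u)%R = tau v * tau (- S u)%R.
Proof. by rewrite tau_split conjgE (tau_commute v u) mulKg. Qed.

End TwistedConjugation.

Section PathGroup.
Local Open Scope ring_scope.
Variables (U : finZmodType) (A : zmodType).

(** The moves are elements of the following group: a pair [(a, f)] translates
    the base point by [a] and adds to an accumulated label the value of [f] at
    the point where it starts.  This is the wreath product of [A] by [U], which
    acts on itself by translations; commutation there is an identity between
    the sums of labels along the two sides of a square. *)
Definition path_group : Type := U * {ffun U -> A}.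
HB.instance Definition _ := Choice.on path_group.

Implicit Types p q r : path_group.

Definition path_mul p q : path_group :=
  (p.1 + q.1, [ffun x => p.2 x + q.2 (x + p.1)]).
Definition path_one : path_group := (0, [ffun=> 0]).
Definition path_inv p : path_group := (- p.1, [ffun x => - p.2 (x - p.1)]).

Lemma path_mulA : associative path_mul.
Proof.
move=> p q r; congr pair => /=; first exact: addrA.
by apply/ffunP => x; rewrite !ffunE /= !addrA.
Qed.

Lemma path_mul1 : left_id path_one path_mul.
Proof.
case=> a f; congr pair => /=; first exact: add0r.
by apply/ffunP => x; rewrite !ffunE /= add0r addr0.
Qed.

Lemma path_1mul : right_id path_one path_mul.
Proof.
case=> a f; congr pair => /=; first exact: addr0.
by apply/ffunP => x; rewrite !ffunE /= addr0.
Qed.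

Lemma path_mulV : left_inverse path_one path_inv path_mul.
Proof.
case=> a f; congr pair => /=; first exact: addNr.
by apply/ffunP => x; rewrite !ffunE /= addNr.
Qed.

Lemma path_Vmul : right_inverse path_one path_inv path_mul.
Proof.
case=> a f; congr pair => /=; first exact: addrN.
by apply/ffunP => x; rewrite !ffunE /= addrK addrN.
Qed.

HB.instance Definition _ :=
  isGroup.Build path_group path_mulA path_mul1 path_1mul path_mulV path_Vmul.

Variables (S : {additive U -> U}) (E : U -> U -> A) (e : U).
Hypothesis E0 : forall x, E x 0 = 0.
Hypothesis ES : forall x u v,
  E x u + E (x + S u) (v - S u) = E x v + E (x + S v) (u - S u).
Hypothesis e_gen : forall u, exists i, u = e *+ i.

Let tau u : path_group := (S u, [ffun x => E x u]).

Let tau0 : tau 0 = 1%g.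
Proof.
by congr pair; [rewrite raddf0 | apply/ffunP => x; rewrite !ffunE].
Qed.

Let tauS u v : (tau u * tau (v - S u)%R)%g = (tau v * tau (u - S u)%R)%g.
Proof.
congr pair => /=; first by rewrite !raddfB addrCA addrA.
by apply/ffunP => x; rewrite !ffunE.
Qed.

Lemma edge_square x u v : E x u + E (x + S u) v = E x v + E (x + S v) u.
Proof.
have /(congr1 (fun p : path_group => p.2 x)) := tau_commute tau0 tauS e_gen u v.
by rewrite /= !ffunE.
Qed.

Lemma edge_addS x u v : E x (v - S u) = E x v + E (x + S v) (- S u).
Proof.
have /(congr1 (fun p : path_group => p.2 x)) := tau_addS tau0 tauS e_gen u v.
by rewrite /= !ffunE.
Qed.

End PathGroup.

(** * Cycles modulo boundaries *)

Lemma inj_surj_bij (A : choiceType) (B : eqType) (f : A -> B) :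
  injective f -> (forall y, exists x, f x = y) -> bijective f.
Proof.
move=> f_inj f_surj; have ex y : exists x, f x == y.
  by have [x <-] := f_surj y; exists x.
exists (fun y => xchoose (ex y)) => [x|y]; last exact: eqP (xchooseP (ex y)).
by apply: f_inj; apply: eqP (xchooseP (ex (f x))).
Qed.

Section Cokernel.
Local Open Scope ring_scope.
Variables (U V W : zmodType) (f : {additive U -> V}) (g : {additive V -> W}).

Definition im : zmodClosed V := GRing.ZmodClosed.clone V (im_pred f) _.
Definition cok : zmodType := Quotient.quot im.
Definition to_cok : {additive V -> cok} := \pi_(Quotient.quot im)%qT.

Lemma to_cok_eq0 v : to_cok v = 0 <-> exists u, f u = v.
Proof.
rewrite -[0](raddf0 to_cok); split.
  by move/eqP; rewrite -Quotient.idealrBE subr0 => /asboolP.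
by move=> im_v; apply/eqP; rewrite -Quotient.idealrBE subr0; apply/asboolP.
Qed.

Lemma to_cok_surj a : exists v, a = to_cok v.
Proof. by exists (repr a); rewrite [RHS]reprK. Qed.

Lemma cok_lift : (forall u, g (f u) = 0) ->
  {gc : {additive cok -> W} | forall v, gc (to_cok v) = g v}.
Proof.
move=> gf0; have g_im v : v \in im -> g v = 0 by move=> /asboolP[u <-].
by exists (quot_lift g_im) => v; apply: quot_liftE.
Qed.

(** If the homology group and [P] are embedded in the same group [M] with the
    same image, then they are isomorphic.  So neither direction of an
    isomorphism has to be constructed: enough cycles and a separating family of
    invariants suffice. *)
Lemma homology_isog (M P : zmodType) (gc : {additive cok -> W})
    (invar : {additive cok -> M}) (theta : {additive P -> M}) :
    (forall v, gc (to_cok v) = g v) ->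
    (forall a, gc a = 0 -> invar a = 0 -> a = 0) ->
    injective theta ->
    (forall w, (exists2 a, gc a = 0 & invar a = w) <-> exists p, theta p = w) ->
  zmod_isog (homology f g) P.
Proof.
move=> gcE invar_inj theta_inj same_im.
have ker_im (z : Defs.ker g) : exists p, theta p == invar (to_cok (val z)).
  suff [p <-] : exists p, theta p = invar (to_cok (val z)) by exists p.
  by apply/same_im; exists (to_cok (val z)); rewrite ?gcE //; apply/eqP/(valP z).
pose h z := xchoose (ker_im z).
have hE z : theta (h z) = invar (to_cok (val z)) := eqP (xchooseP (ker_im z)).
have h_add : zmod_morphism h.
  by move=> y z; apply: theta_inj; rewrite raddfB !hE !raddfB.
pose ha : {additive Defs.ker g -> P} :=
  HB.pack h (GRing.isZmodMorphism.Build (Defs.ker g) P h h_add).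
pose I := GRing.ZmodClosed.clone (Defs.ker g) (@boundary_pred U V W f g) _.
have I_eq0 (z : Defs.ker g) : z \in I <-> invar (to_cok (val z)) = 0.
  split=> [/asboolP /to_cok_eq0 ->|z0]; first exact: raddf0.
  apply/asboolP/to_cok_eq0/invar_inj => //.
  by rewrite gcE; apply/eqP/(valP z).
have ha_I z : z \in I -> ha z = 0.
  by move=> /I_eq0 z0; apply: theta_inj; rewrite hE z0 raddf0.
exists (quot_lift ha_I); apply: inj_surj_bij.
  apply: raddf_inj => q; rewrite -[q]reprK.
  move: (repr q) => z; rewrite [X in X = _ -> _]quot_liftE => haz0.
  rewrite -[RHS](raddf0 (\pi_(Quotient.quot I) : {additive _ -> _})%qT).
  apply/eqP; rewrite -Quotient.idealrBE subr0; apply/I_eq0.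
  by rewrite -hE [h z]haz0 raddf0.
move=> p; have [a ga0 phia] : exists2 a, gc a = 0 & invar a = theta p.
  by apply/same_im; exists p.
have [v av] := to_cok_surj a.
have gv0 : ker_pred g v by rewrite /ker_pred -gcE -av ga0.
exists (\pi_(Quotient.quot I) (Ker gv0))%qT.
by rewrite [LHS]quot_liftE; apply: theta_inj; rewrite hE -av.
Qed.

End Cokernel.

(** * The group of edges *)

Lemma gen_sum (I : finType) (c : freeZ I) : c = (\sum_i gen i *~ c i)%R.
Proof.
apply/ffunP => j; rewrite sum_ffunE (bigD1 j) //= big1 => [|i /negbTE ij].
  by rewrite addr0 ffunMzE ffunE eqxx intz.
by rewrite ffunMzE ffunE eq_sym ij mul0rz.
Qed.

Section EdgeGroup.
Local Open Scope ring_scope.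
Local Open Scope quandle_scope.
Variable X : finQuandle.

(** Chains modulo boundaries: cycles of this group are homology classes, and
    additive maps out of it are 2-cocycles ([edge_lift]). *)
Definition edge_group : zmodType := cok (bnd3 X).
Definition edge (x y : X) : edge_group := to_cok (bnd3 X) (gen2 x y).

Lemma edgexx x : edge x x = 0.
Proof. by rewrite /edge gen2xx raddf0. Qed.

Lemma edge_rel x y z :
  edge x y + edge (x ◁ y) z = edge x z + edge (x ◁ z) (y ◁ z).
Proof.
apply/eqP; rewrite -subr_eq0 -oppr_eq0; apply/eqP.
have <- : to_cok (bnd3 X) (bnd3 X (gen3 x y z)) = 0.
  by apply/to_cok_eq0; exists (gen3 x y z).
rewrite bnd3E [RHS]raddfD 2!(raddfB (to_cok _)) -!/(edge _ _).
rewrite opprB opprD addrA -[in RHS]addrA -[RHS]addrA.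
by rewrite (addrC (- edge _ z)) (addrC (- edge x y)) !addrA.
Qed.

Lemma edge_sum (a : edge_group) :
  exists c : freeZ (X * X)%type, a = \sum_p edge p.1 p.2 *~ c p.
Proof.
have [v ->] := to_cok_surj a; rewrite -[v]reprK.
exists (repr v); rewrite {1}[repr v]gen_sum !raddf_sum.
by apply: eq_bigr => -[x y] _; rewrite !raddfMz.
Qed.

Lemma edge_lift (V : zmodType) (f : X -> X -> V) :
    (forall x, f x x = 0) ->
    (forall x y z, f x y + f (x ◁ y) z = f x z + f (x ◁ z) (y ◁ z)) ->
  {F : {additive edge_group -> V} | forall x y, F (edge x y) = f x y}.
Proof.
move=> fxx f_rel; pose f0 : {additive _ -> V} := linext (fun p => f p.1 p.2).
have f0_degen v : v \in degen2 X -> f0 v = 0.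
  by apply: span_kill => x; rewrite [f0 _]linext_gen.
pose f2 : {additive chain2 X -> V} := quot_lift f0_degen.
have f2E x y : f2 (gen2 x y) = f x y by rewrite [LHS]quot_liftE [LHS]linext_gen.
have f2_bnd c : f2 (bnd3 X c) = 0.
  rewrite -[c]reprK [bnd3 _ _]quot_liftE (raddf_sum f2) big1 //.
  move=> [[x y] z] _; rewrite raddfMz raddfD 2!raddfB !f2E.
  rewrite (_ : _ + _ = 0) ?mul0rz //.
  apply/eqP; rewrite addrAC subr_eq0 addrAC subr_eq -f_rel addrC.
  by [].
by have [F FE] := cok_lift f2_bnd; exists F => x y; rewrite FE.
Qed.

Lemma edge_bnd : {F : {additive edge_group -> chain1 X} |
  (forall v, F (to_cok (bnd3 X) v) = bnd2 X v)
  & forall x y, F (edge x y) = gen x - gen (x ◁ y)}.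
Proof.
have [F FE] := cok_lift (@bnd2_bnd3 X); exists F => // x y.
by rewrite FE bnd2E.
Qed.

End EdgeGroup.

(** * Residues *)

Section Residues.
Local Open Scope ring_scope.
Variable n : nat.
Hypothesis n_gt0 : (0 < n)%N.

Definition zmodn (z : int) : Zmodn n := Zp1 *~ z.

Lemma zmodn_zmod_morphism : zmod_morphism zmodn.
Proof. by move=> y z; rewrite /zmodn mulrzBr. Qed.
HB.instance Definition _ := GRing.isZmodMorphism.Build int (Zmodn n) zmodn
  zmodn_zmod_morphism.

Lemma zmodn_nat (k : nat) : zmodn k%:Z = inZp k.
Proof.
rewrite /zmodn -pmulrn Zp_mulrn; apply: val_inj => /=.
by rewrite modnMml mul1n.
Qed.

Lemma zmodn_val (x : Zmodn n) : zmodn (x : nat)%:Z = x.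
Proof. by rewrite zmodn_nat valZpK. Qed.

Lemma zmodn_eq0 z : (zmodn z == 0) = (n%:Z %| z)%Z.
Proof.
have nat_case (k : nat) : (zmodn k%:Z == 0) = (n %| k)%N.
  by rewrite zmodn_nat -val_eqE /= prednK.
by case: z => k; rewrite dvdzE /= ?NegzE ?raddfN ?oppr_eq0 nat_case.
Qed.

Lemma zmodn_mod z : zmodn (z %% n)%Z = zmodn z.
Proof.
apply/eqP; rewrite -subr_eq0 -raddfB zmodn_eq0.
by rewrite -eqz_mod_dvd modz_mod.
Qed.

Lemma val_zmodn z : (zmodn z : nat)%:Z = (z %% n)%Z.
Proof.
have n0 : n%:Z != 0 by rewrite eqz_nat -lt0n.
rewrite -zmodn_mod; have := ltz_pmod z (n_gt0 : 0 < n%:Z).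
case: (z %% n)%Z (modz_ge0 z n0) => // k _ lt_kn.
by rewrite zmodn_nat /= prednK // modn_small.
Qed.

Lemma val_zmodn_small (k : nat) : (k < n)%N -> zmodn k = k :> nat.
Proof. by move=> ltkn; rewrite zmodn_nat /= prednK // modn_small. Qed.

Lemma zmodnMz z (x : Zmodn n) : x *~ z = zmodn (z * x).
Proof. by rewrite -[x in LHS]zmodn_val /zmodn -mulrzA mulrC. Qed.

End Residues.

(** * The kernel of the total displacement *)

Lemma sum_kronecker (m j : nat) : (j < m)%N ->
  (\sum_(k < m - 1) k.+1%:Z * (k.+1 == j)%:Z = j%:Z)%R.
Proof.
case: j => [|j] ltjm; first by rewrite big1 // => k _; rewrite mulr0.
have lt_j : (j < m - 1)%N by lia.
rewrite (bigD1 (Ordinal lt_j)) //= eqxx mulr1 big1 ?addr0 // => k.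
by rewrite -val_eqE /= eqSS => /negbTE->; rewrite mulr0.
Qed.

Section Lattice.
Local Open Scope ring_scope.
Variables m N : nat.
Hypotheses (m_gt0 : (0 < m)%N) (N_gt0 : (0 < N)%N).

(** In each orbit: how many edges there are with label [k] modulo [m], for [k]
    from 1 to [m - 1] (the index is shifted, so that index [k] stands for
    [k.+1]), and the sum modulo [N] of the quotients of the labels by [m]. *)
Definition invariants : zmodType :=
  ({ffun 'I_m * 'I_(m - 1) -> int} * {ffun 'I_m -> Zmodn N})%type.
Local Notation W := invariants.

(** An edge with label [u = k + m * q] is a translation by [u] of the orbit, seen
    as Z/N; this is the total translation of a chain in orbit [r]. *)
Definition disp r (w : W) : Zmodn N :=
  zmodn N (\sum_(k < m - 1) k.+1%:Z * w.1 (r, k)) + w.2 r *+ m.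

Lemma disp_zmod_morphism r : zmod_morphism (disp r).
Proof.
move=> v w; rewrite /disp !ffunE mulrnBl.
rewrite [in RHS]opprD [RHS]addrACA -raddfB -sumrB.
by congr (zmodn _ _ + _); apply: eq_bigr => k _; rewrite !ffunE mulrBr.
Qed.
HB.instance Definition _ r := GRing.isZmodMorphism.Build W (Zmodn N) (disp r)
  (disp_zmod_morphism r).

Let d := gcdn m N.
Local Notation P :=
  ({ffun 'I_((m - 1) * m) -> int} * {ffun 'I_m -> Zmodn d})%type.
Variables (alpha : int) (idx : 'I_m * 'I_(m - 1) -> 'I_((m - 1) * m)).
Hypotheses (alphaP : (N %| alpha * m%:Z - d%:Z)%Z) (idx_bij : bijective idx).

Let d_gt0 : (0 < d)%N. Proof. by rewrite gcdn_gt0 m_gt0. Qed.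
Let dN : (d %| N)%N. Proof. exact: dvdn_gcdr. Qed.
Let dm : (d %| m)%N. Proof. exact: dvdn_gcdl. Qed.
Let NE : N%:Z = (N %/ d)%N%:Z * d%:Z. Proof. by rewrite -PoszM divnK. Qed.

(** The values of [q] with displacement 0 form the [m]-torsion of Z/N, which is
    its subgroup of order [d], generated by [N / d]. *)
Definition torsion (b : Zmodn d) : Zmodn N :=
  zmodn N ((N %/ d)%N%:Z * (b : nat)%:Z).

Lemma torsionE z : torsion (zmodn d z) = zmodn N ((N %/ d)%N%:Z * z).
Proof.
apply/eqP; rewrite -subr_eq0 -raddfB zmodn_eq0 // -mulrBr [X in (X %| _)%Z]NE.
rewrite dvdz_mul // val_zmodn // -eqz_mod_dvd modz_mod //.
Qed.

Lemma torsion_zmod_morphism : zmod_morphism torsion.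
Proof.
move=> a b; rewrite -[a]zmodn_val -1?[b]zmodn_val // -raddfB !torsionE.
by rewrite mulrBr raddfB.
Qed.
HB.instance Definition _ := GRing.isZmodMorphism.Build (Zmodn d) (Zmodn N)
  torsion torsion_zmod_morphism.

Lemma torsion_inj : injective torsion.
Proof.
apply: raddf_inj => b /eqP; rewrite zmodn_eq0 // [X in (X %| _)%Z]NE dvdz_mul2l.
  by rewrite -zmodn_eq0 // zmodn_val // => /eqP.
by rewrite eqz_nat -lt0n divn_gt0 // dvdn_leq.
Qed.

(** The count of the label 1 is determined by the other ones and by the value of
    [sum k * c_k], which has to be a multiple of [d].  So the first coordinate
    of [e] encodes the quotient of that sum by [d], and [unfold_first] recovers
    the counts.  [first] is written as a sum so as to be 0 when [m = 1] and
    there is no first coordinate. *)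
Definition first (e : 'I_(m - 1) -> int) : int :=
  \sum_(k < m - 1 | k == 0%N :> nat) e k.
Definition rest (e : 'I_(m - 1) -> int) : int :=
  \sum_(k < m - 1 | k != 0%N :> nat) k.+1%:Z * e k.
Definition unfold_first (e : 'I_(m - 1) -> int) (k : 'I_(m - 1)) : int :=
  if k == 0%N :> nat then d%:Z * e k - rest e else e k.

(** Since [alpha * m] is [d] modulo [N], the second component
    [- alpha * first e] compensates the displacement [d * first e] of the first
    one; the remaining freedom is the torsion part. *)
Definition theta (p : P) : W :=
  ([ffun q : 'I_m * 'I_(m - 1) => unfold_first (fun k => p.1 (idx (q.1, k))) q.2],
   [ffun r => torsion (p.2 r)
      - zmodn N (alpha * first (fun k => p.1 (idx (r, k))))]).

Lemma theta_zmod_morphism : zmod_morphism theta.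
Proof.
move=> p q; congr pair; apply/ffunP; [case=> r k | move=> r]; rewrite !ffunE.
  rewrite /unfold_first /=; case: ifP => _; last by rewrite !ffunE.
  rewrite /rest !ffunE mulrBr [in RHS]opprD [RHS]addrACA -opprD; congr (_ - _).
  by rewrite -sumrB; apply: eq_bigr => j _; rewrite !ffunE mulrBr.
rewrite [in RHS]opprD [RHS]addrACA -opprD; congr (_ - _); first exact: raddfB.
rewrite -raddfB -mulrBr /first -sumrB; congr (zmodn N (_ * _)).
by apply: eq_bigr => j _; rewrite !ffunE.
Qed.
HB.instance Definition _ := GRing.isZmodMorphism.Build P W theta
  theta_zmod_morphism.

Lemma sum_unfold_first (e : 'I_(m - 1) -> int) :
  \sum_(k < m - 1) k.+1%:Z * unfold_first e k = d%:Z * first e.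
Proof.
rewrite /unfold_first /first /rest.
case: (m - 1)%N e => [|q] e; first by rewrite !big_ord0 mulr0.
rewrite (bigD1 ord0) //= mul1r [in RHS](big_pred1 ord0) // -[RHS]addr0 -addrA.
congr (_ + _); rewrite addrC -sumrB big1 // => k k0.
by rewrite ifN // subrr.
Qed.

Lemma theta_inj : injective theta.
Proof.
have [idx' idxK idxK'] := idx_bij.
apply: raddf_inj => -[e b] theta0.
have unf0 r k : unfold_first (fun k => e (idx (r, k))) k = 0.
  by have /(congr1 (fun w : W => w.1 (r, k))) := theta0; rewrite !ffunE.
have e0 r k : e (idx (r, k)) = 0.
  have := unf0 r k; rewrite /unfold_first; case: ifP => // _.
  rewrite /rest big1 => [|j j0].
    by rewrite subr0 => /eqP; rewrite mulf_eq0 eqz_nat gtn_eqF //= => /eqP.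
  by have := unf0 r j; rewrite /unfold_first (negbTE j0) => ->; rewrite mulr0.
congr pair; apply/ffunP => j; rewrite ffunE.
  by rewrite -[j]idxK'; case: (idx' j).
apply/torsion_inj; rewrite [RHS]raddf0.
have /(congr1 (fun w : W => w.2 j)) := theta0; rewrite !ffunE /=.
by rewrite /first big1 // mulr0 raddf0 addr0.
Qed.

Lemma disp_eq0 r (w : W) : (disp r w == 0) =
  (N %| \sum_(k < m - 1) k.+1%:Z * w.1 (r, k) + (w.2 r : nat)%:Z * m%:Z)%Z.
Proof.
rewrite -zmodn_eq0 // /disp -{1}[w.2 r]zmodn_val // pmulrn -raddfMz /= mulrzz.
by rewrite -raddfD.
Qed.

Lemma unfold_first_surj (c : 'I_(m - 1) -> int) :
    (d %| \sum_(k < m - 1) k.+1%:Z * c k)%Z ->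
  exists e, unfold_first e =1 c.
Proof.
rewrite /unfold_first /rest; case: (m - 1)%N c => [|q] c d_c.
  by exists c => -[].
exists (fun k : 'I_q.+1 => if k == 0%N :> nat
  then ((\sum_(k < q.+1) k.+1%:Z * c k)%R %/ d)%Z else c k) => k.
case: (eqVneq (k : nat) 0%N) => [k0|//].
rewrite mulrC divzK // (bigD1 k) //= k0 mul1r.
rewrite (eq_bigl (fun j : 'I_q.+1 => j != 0%N :> nat)) => [|j]; last first.
  by rewrite -val_eqE /= k0.
rewrite -addrA -sumrB big1 ?addr0 // => j j0.
by rewrite ifN // subrr.
Qed.

Lemma torsion_mul_m b : torsion b *+ m = 0.
Proof.
rewrite -raddfMn (_ : b *+ m = 0) ?raddf0 // -[b]zmodn_val // -raddfMn.
by apply/eqP; rewrite zmodn_eq0 // pmulrn mulrzz dvdz_mull.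
Qed.

(** Given [w] of displacement 0, [d] divides the sum [sum k * c_k], so that it is
    [d * first e] for some [e].  With [y = q + alpha * first e], [d * y] is
    [alpha] times the displacement modulo [N], hence 0; so [N / d] divides [y],
    which is to say that [y] is torsion. *)
Lemma theta_image w : (forall r, disp r w = 0) <-> exists p, theta p = w.
Proof.
split=> [disp0|[p <-] r]; last first.
  rewrite /disp /=; under eq_bigr => k _ do rewrite ffunE /=.
  rewrite sum_unfold_first ffunE mulrnBl torsion_mul_m sub0r -raddfMn -raddfB.
  apply/eqP; rewrite zmodn_eq0 // pmulrn mulrzz mulrAC -mulrBl dvdz_mulr //.
  by rewrite -opprB rpredN.
have /choice[e eE] r : exists e, unfold_first e =1 (fun k => w.1 (r, k)).
  apply: unfold_first_surj; have /eqP := disp0 r; rewrite disp_eq0.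
  move=> /(dvdz_trans (dN : (d %| N%:Z)%Z)); rewrite rpredDr //.
  by apply: dvdz_mull.
have /choice[b bE] r :
    exists b, torsion b = w.2 r + zmodn N (alpha * first (e r)).
  set y := (w.2 r : nat)%:Z + alpha * first (e r).
  have Ny : ((N %/ d)%N%:Z %| y)%Z.
    have : (N %| d%:Z * y)%Z.
      have /eqP := disp0 r; rewrite disp_eq0.
      under eq_bigr => k _ do rewrite -eE.
      rewrite sum_unfold_first => Nmy.
      have -> : d%:Z * y = alpha * (d%:Z * first (e r) + (w.2 r : nat)%:Z * m%:Z)
         - (alpha * m%:Z - d%:Z) * (w.2 r : nat)%:Z by rewrite /y; ring.
      by apply: rpredB; [apply: dvdz_mull | apply: dvdz_mulr].
    by rewrite [X in (X %| _)%Z]NE [_ * d%:Z]mulrC dvdz_mul2l // eqz_nat -lt0n.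
  exists (zmodn d (y %/ (N %/ d)%N)%Z); rewrite torsionE mulrC divzK //.
  by rewrite /y raddfD /= zmodn_val.
have [idx' idxK idxK'] := idx_bij.
pose f := [ffun i => e (idx' i).1 (idx' i).2].
have fE r : (fun k => f (idx (r, k))) = e r.
  by apply/funext => k; rewrite ffunE idxK.
exists (f, [ffun r => b r]); rewrite [RHS]surjective_pairing.
congr pair; apply/ffunP; [case=> r k | move=> r]; rewrite ffunE /= fE ?eE //.
by rewrite ffunE bE addrK.
Qed.

Lemma disp_kernel_of_bezout : exists theta : {additive P -> W}, injective theta /\
  forall w, (forall r, disp r w = 0) <-> exists p, theta p = w.
Proof. by exists theta; split; [apply: theta_inj | apply: theta_image]. Qed.

End Lattice.

(** * Invariants of edges *)

(** The map [S] is multiplication by [m * s], where [s] is invertible modulo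
    [N = n / m], with inverse [s'].  Orbits are indexed by residues modulo [m].
    Of the group of edges of the quandle, only its universal property is used:
    it is a group [A] generated by the values of a universal cocycle [E]. *)

Section EdgeInvariants.
Local Open Scope ring_scope.
Variables (n m N : nat) (S : {additive Zmodn n -> Zmodn n}) (s s' : int).
Hypotheses (n_gt0 : (0 < n)%N) (nE : n = (m * N)%N).
Hypothesis SE : forall z, S (zmodn n z) = zmodn n (m%:Z * s * z).
Hypothesis ss' : (N %| s * s' - 1)%Z.
Local Notation U := (Zmodn n).

Let m_gt0 : (0 < m)%N. Proof. by move: n_gt0; rewrite nE muln_gt0 => /andP[]. Qed.
Let N_gt0 : (0 < N)%N. Proof. by move: n_gt0; rewrite nE muln_gt0 => /andP[]. Qed.

Let nEz : n%:Z = m%:Z * N%:Z. Proof. by rewrite -PoszM -nE. Qed.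

Definition cls (x : U) : 'I_m := Ordinal (ltn_pmod x m_gt0).
Definition divm (u : U) : Zmodn N := zmodn N (u %/ m)%N.

Lemma val_addU (v w : U) : (v + w : U) = ((v + w) %% n)%N :> nat.
Proof. by congr (_ %% _)%N; apply: prednK. Qed.

Lemma modm_add (v w : U) : (m %| w)%N -> ((v + w)%R %% m = v %% m)%N.
Proof.
move=> mw; rewrite val_addU modn_dvdm; last by rewrite nE dvdn_mulr.
by rewrite -modnDmr (eqP mw) addn0.
Qed.

(** Reduction modulo [n = m * N] changes the quotient by [m] only by multiples of
    [N], and there is no carry from the remainders when [m] divides [w]. *)
Lemma divmD (v w : U) : (m %| w)%N -> divm (v + w) = divm v + divm w.
Proof.
move=> mw; rewrite /divm val_addU -raddfD /= -PoszD -divnDr //.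
apply/eqP; rewrite eq_sym -subr_eq0 -raddfB zmodn_eq0 //.
move: (v + w)%N => t.
rewrite {1}(divn_eq t n) {2}nE [(m * N)%N]mulnC mulnA divnMDl //.
by rewrite PoszD addrK PoszM dvdz_mull.
Qed.

Lemma dvdn_S u : (m %| S u)%N.
Proof.
suff : (m %| (S u : nat)%:Z)%Z by [].
rewrite -[u]zmodn_val // SE val_zmodn // nEz -mulrA -mulz_modr //.
by rewrite dvdz_mulr.
Qed.

Lemma S_surj (w : U) : (m %| w)%N -> exists u, w = S u.
Proof.
move=> mw; exists (zmodn n (s' * (w %/ m)%N)); rewrite SE.
rewrite -{1}[w]zmodn_val //; apply/eqP.
rewrite eq_sym -subr_eq0 -raddfB zmodn_eq0 //.
rewrite -{2}(divnK mw) nEz !PoszM.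
have -> : m%:Z * s * (s' * (w %/ m)%N) - (w %/ m)%N%:Z * m =
    m%:Z * (s * s' - 1) * (w %/ m)%N by ring.
by rewrite dvdz_mulr // dvdz_mul.
Qed.

(** So [x |-> divm x *~ s'] is a coordinate on each orbit in which an edge with
    label [u] is a translation by [u]. *)
Lemma divm_S u : divm (S u) *~ s' = zmodn N u.
Proof.
rewrite /divm -{1}[u]zmodn_val // SE -divz_nat val_zmodn // nEz.
rewrite -mulrA -mulz_modr // mulKz ?zmodn_mod //; last by lia.
rewrite -raddfMz; apply/eqP; rewrite -subr_eq0 -raddfB zmodn_eq0 //.
have -> : (s * u%:Z) *~ s' - u%:Z = (s * s' - 1) * u%:Z.
  by rewrite mulrzz; ring.
by rewrite dvdz_mulr.
Qed.

Variables (A : zmodType) (E : U -> U -> A) (bnd : {additive A -> freeZ U}).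
Definition cocycle (V : zmodType) (f : U -> U -> V) :=
  (forall x, f x 0 = 0) /\
  (forall x u v, f x u + f (x + S u) (v - S u) = f x v + f (x + S v) (u - S u)).
Hypothesis E_cocycle : cocycle E.
Hypothesis E_sum : forall a, exists c : freeZ (U * U)%type,
  a = \sum_p E p.1 p.2 *~ c p.
Hypothesis E_lift : forall (V : zmodType) (f : U -> U -> V), cocycle f ->
  {F : {additive A -> V} | forall x u, F (E x u) = f x u}.
Hypothesis bndE : forall x u, bnd (E x u) = gen x - gen (x + S u).

Lemma E_ext (V : zmodType) (F G : {additive A -> V}) :
  (forall x u, F (E x u) = G (E x u)) -> F =1 G.
Proof.
move=> FG a; have [c ->] := E_sum a; rewrite !raddf_sum.
by apply: eq_bigr => p _; rewrite !raddfMz FG.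
Qed.

Lemma U_gen (u : U) : exists i, u = Zp1 *+ i.
Proof. by exists u; rewrite -{1}[u]zmodn_val // /zmodn pmulrn. Qed.

Lemma E_square x u v : E x u + E (x + S u) v = E x v + E (x + S v) u.
Proof. by case: E_cocycle => E0 ES; apply: (edge_square E0 ES U_gen). Qed.

Lemma E_add x (v w : U) : (m %| w)%N -> E x (v + w) = E x v + E (x + S v) w.
Proof.
case: E_cocycle => E0 ES /S_surj[u ->].
by rewrite -[u]opprK raddfN (edge_addS E0 ES U_gen).
Qed.

Lemma cls_addS x u : cls (x + S u) = cls x.
Proof. by apply: val_inj => /=; rewrite modm_add ?dvdn_S. Qed.

Local Notation W := (invariants m N).

Definition edge_invar (x u : U) : invariants m N :=
  ([ffun p : 'I_m * 'I_(m - 1) => ((p.1 == cls x) && (p.2.+1 == u %% m)%N)%:Z],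
   [ffun r => if r == cls x then divm u else 0]).

Lemma edge_invar_cocycle : cocycle edge_invar.
Proof.
split=> [x|x u v]; congr pair; apply/ffunP => p; rewrite !ffunE.
- by rewrite /= mod0n andbF.
- by rewrite /divm div0n raddf0 if_same.
- rewrite !cls_addS !modm_add -?raddfN ?dvdn_S //.
  by rewrite addrC.
- rewrite !cls_addS; case: ifP => // _.
  by rewrite !divmD -?raddfN ?dvdn_S // addrCA.
Qed.

Definition invar : {additive A -> W} := sval (E_lift edge_invar_cocycle).
Lemma invarE x u : invar (E x u) = edge_invar x u.
Proof. by have -> := proj2_sig (E_lift edge_invar_cocycle).
Qed.

(** The displacement of an edge is the difference of the coordinates of its ends,
    so [disp r \o invar] factors through the boundary map. *)
Lemma disp_cycle r a : bnd a = 0 -> disp r (invar a) = 0.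
Proof.
pose pot : {additive freeZ U -> Zmodn N} :=
  linext (fun x => if r == cls x then - (divm x *~ s') else 0).
suff /(_ a) : pot \o bnd =1 disp r \o invar.
  by move=> /= <- ->; rewrite raddf0.
apply: E_ext => x u /=.
rewrite bndE raddfB 2![pot _]linext_gen cls_addS invarE /disp /=.
rewrite !ffunE; case: ifP => [/eqP-> | rx].
  rewrite divmD ?dvdn_S // opprK mulrzDl addKr divm_S.
  under eq_bigr => k _ do rewrite ffunE /= eqxx /=.
  rewrite sum_kronecker ?ltn_pmod // /divm pmulrn -raddfMz -raddfD.
  by rewrite mulrzz {1}(divn_eq u m) PoszD PoszM addrC.
rewrite subr0 mul0rn addr0 big1 ?raddf0 // => k _.
by rewrite ffunE /= rx mulr0.
Qed.

(** * Realizing invariants by cycles *)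

Definition rep (r : 'I_m) : U := zmodn n (r : nat).

Lemma dvd_zmodn z : (m %| (zmodn n z : nat))%N = (m %| z)%Z.
Proof.
rewrite -[LHS]/(m %| (zmodn n z : nat)%:Z)%Z val_zmodn //.
rewrite [in RHS](divz_eq z n) [RHS]rpredDl //.
by rewrite [X in _ * X]nEz mulrCA; apply: dvdz_mulr.
Qed.

Lemma cls_rep r : cls (rep r) = r.
Proof.
apply: val_inj => /=; rewrite val_zmodn_small ?modn_small //.
by rewrite nE (leq_trans (ltn_ord r)) // leq_pmulr.
Qed.

Lemma cls_eqP x y : cls x = cls y -> exists v, y = x + S v.
Proof.
move=> /(congr1 val) /= xy; have [|v yx] := S_surj (w := y - x).
  rewrite -[y]zmodn_val // -[x in _ - x]zmodn_val // -raddfB dvd_zmodn.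
  by rewrite -eqz_mod_dvd !modz_nat eqz_nat xy.
by exists v; rewrite -yx addrC subrK.
Qed.

Let one_U : U := zmodn n 1.

Lemma one_gen (u : U) : one_U *+ u = u.
Proof. by rewrite -[RHS]zmodn_val // pmulrn -raddfMz /= intz. Qed.

Definition unitC (p : 'I_m * 'I_(m - 1)) : W := (gen p, 0).
Definition unitQ (r : 'I_m) (h : Zmodn N) : W :=
  (0, [ffun r' => if r' == r then h else 0]).

Lemma unit_decomp (w : W) : w = \sum_p unitC p *~ w.1 p + \sum_r unitQ r (w.2 r).
Proof.
rewrite [LHS]surjective_pairing; apply: injective_projections;
  rewrite raddfD !raddf_sum /=.
  rewrite [X in _ + X]big1 // addr0 {1}[w.1]gen_sum; apply: eq_bigr => p _.
  by rewrite raddfMz.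
rewrite [X in X + _]big1 => [|p _]; last by rewrite raddfMz mul0rz.
rewrite add0r; apply/ffunP => r; rewrite sum_ffunE (bigD1 r) //= ffunE eqxx.
by rewrite big1 ?addr0 // => r' /negbTE; rewrite ffunE eq_sym => ->.
Qed.

Lemma repC_lt (k : 'I_(m - 1)) : (k.+1 < m)%N.
Proof. by have := ltn_ord k; lia. Qed.

Lemma le_mn : (m <= n)%N. Proof. by rewrite nE leq_pmulr. Qed.

Lemma invar_repC (p : 'I_m * 'I_(m - 1)) :
  invar (E (rep p.1) (zmodn n p.2.+1)) = unitC p.
Proof.
case: p => r k /=; have ltkm := repC_lt k.
have ltkn := leq_trans ltkm le_mn.
rewrite invarE /edge_invar /divm val_zmodn_small // cls_rep.
rewrite modn_small // divn_small //.
by congr pair; apply/ffunP => q; rewrite !ffunE ?raddf0 ?if_same.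
Qed.

Lemma repQ_lt (h : Zmodn N) : (m * h < n)%N.
Proof. by rewrite nE ltn_pmul2l // -[X in (_ < X)%N](prednK N_gt0). Qed.

Lemma invar_repQ (r : 'I_m) (h : Zmodn N) :
  invar (E (rep r) (zmodn n (m * h)%N)) = unitQ r h.
Proof.
have lt_mh := repQ_lt h.
rewrite invarE /edge_invar /divm val_zmodn_small // cls_rep.
rewrite modnMr mulKn // zmodn_val //.
by congr pair; apply/ffunP => q; rewrite !ffunE // andbF.
Qed.

Section ClosingLoops.
Hypothesis m_gt1 : (1 < m)%N.

Let n_gt1 : (1 < n)%N.
Proof. by rewrite nE (leq_trans m_gt1) // leq_pmulr. Qed.

Let k0 : 'I_(m - 1) := Ordinal (etrans (subn_gt0 1 m) m_gt1).

Lemma invar_one x : invar (E x one_U) = unitC (cls x, k0).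
Proof.
rewrite invarE /edge_invar /divm val_zmodn_small //; congr pair.
  by apply/ffunP => -[r k]; rewrite !ffunE /= modn_small // eqSS xpair_eqE.
by apply/ffunP => r; rewrite !ffunE divn_small // raddf0 if_same.
Qed.

(** Moves by 1 reach every point of the orbit, so they can close up any path. *)
Definition walk (x : U) (j : nat) := \sum_(i < j) E (x + S (one_U *+ i)) one_U.

Lemma bnd_walk x j : bnd (walk x j) = gen x - gen (x + S (one_U *+ j)).
Proof.
elim: j => [|j IHj]; first by rewrite [walk _ _]big_ord0 !raddf0 addr0 subrr.
by rewrite [walk _ _]big_ord_recr raddfD IHj bndE subrKA -addrA -raddfD -mulrSr.
Qed.

Lemma invar_walk x j : invar (walk x j) = unitC (cls x, k0) *+ j.
Proof.
rewrite raddf_sum /=; under eq_bigr => i _ do rewrite invar_one cls_addS.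
by rewrite sumr_const card_ord.
Qed.

Definition loop (x u : U) := E x u - walk x u.

Lemma bnd_loop x u : bnd (loop x u) = 0.
Proof. by rewrite raddfB bndE bnd_walk one_gen subrr. Qed.

(** The loops through the edges with the prescribed invariants have the right
    invariants, except for the moves 1 that close them up.  Their number in
    orbit [r] is the integer displacement [t r], a multiple of [N]; this is
    corrected by walking [t r / N] times around the orbit. *)
Lemma cycle_realize_several w : (forall r, disp r w = 0) ->
  exists2 a, bnd a = 0 & invar a = w.
Proof.
move=> disp0.
pose t r : int := \sum_(k < m - 1) k.+1%:Z * w.1 (r, k) + (w.2 r : nat)%:Z * m%:Z.
have Nt r : (N %| t r)%Z.
  rewrite -zmodn_eq0 // raddfD -[X in _ + zmodn _ X]mulrzz -pmulrn raddfMn /=.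
  by rewrite zmodn_val //; apply/eqP/disp0.
exists (\sum_(p : 'I_m * 'I_(m - 1)) loop (rep p.1) (zmodn n p.2.+1) *~ w.1 p
   + \sum_r loop (rep r) (zmodn n (m * w.2 r)%N)
   + \sum_r walk (rep r) N *~ (t r %/ N)%Z).
  rewrite !raddfD !raddf_sum !big1 ?addr0 // => r _;
    rewrite ?raddfMz ?bnd_loop ?mul0rz // bnd_walk.
  have -> : S (one_U *+ N) = 0.
    rewrite -raddfMn SE -[RHS](raddf0 (zmodn n)); apply/eqP.
    rewrite -subr_eq0 -raddfB zmodn_eq0 // subr0 pmulrn mulrzz mul1r.
    by rewrite mulrAC -nEz dvdz_mulr.
  by rewrite addr0 subrr mul0rz.
rewrite [RHS]unit_decomp !raddfD !raddf_sum /=.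
have invar_loop x (k : nat) : (k < n)%N ->
    invar (loop x (zmodn n k)) = invar (E x (zmodn n k)) - unitC (cls x, k0) *+ k.
  by move=> ltkn; rewrite raddfB invar_walk val_zmodn_small.
have -> : \sum_(p : 'I_m * 'I_(m - 1))
      invar (loop (rep p.1) (zmodn n p.2.+1) *~ w.1 p) =
    \sum_p unitC p *~ w.1 p
    - \sum_r unitC (r, k0) *~ \sum_(k < m - 1) k.+1%:Z * w.1 (r, k).
  under [X in _ - X]eq_bigr => r _ do rewrite mulrz_sumr.
  rewrite pair_big -sumrB; apply: eq_bigr => -[r k] _ /=.
  rewrite raddfMz invar_loop ?(leq_trans (repC_lt k)) ?le_mn //.
  rewrite (invar_repC (r, k)) cls_rep.
  by rewrite mulrzBl pmulrn mulrzA.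
have -> : \sum_r invar (loop (rep r) (zmodn n (m * w.2 r)%N)) =
    \sum_r unitQ r (w.2 r) - \sum_r unitC (r, k0) *~ ((w.2 r : nat)%:Z * m%:Z).
  rewrite -sumrB; apply: eq_bigr => r _.
  rewrite invar_loop ?repQ_lt // invar_repQ cls_rep mulnC pmulrn PoszM //.
have -> : \sum_r invar (walk (rep r) N *~ (t r %/ N)%Z) =
    \sum_r unitC (r, k0) *~ t r.
  apply: eq_bigr => r _; rewrite raddfMz invar_walk cls_rep pmulrn -mulrzA.
  by rewrite mulrC divzK.
rewrite addrACA -opprD -big_split /=.
by under [X in _ - X + _]eq_bigr => r _ do rewrite -mulrzDr; rewrite subrK.
Qed.

End ClosingLoops.

Lemma cycle_realize w : (forall r, disp r w = 0) ->
  exists2 a, bnd a = 0 & invar a = w.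
Proof.
have [m1|m_neq1] := eqVneq m 1%N; last by apply: cycle_realize_several; lia.
have no_k (k : 'I_(m - 1)) : False by have := repC_lt k; lia.
move=> disp0; exists 0; rewrite !raddf0 // [w]surjective_pairing; congr pair.
  by apply/ffunP => -[r k]; have := no_k k.
apply/ffunP => r; rewrite ffunE -(disp0 r) /disp.
rewrite big1 => [|k]; last by have := no_k k.
by rewrite raddf0 add0r; move: (w.2 r) => h; rewrite m1.
Qed.

(** * Cycles without invariants vanish *)

(** If [m = 1], then [E_add] applies to all labels and every point [x] is [S a]
    for [a = x *~ s'], so that [E x u = E 0 (a + u) - E 0 a]: an edge is the
    difference of the values of a potential at its ends. *)
Lemma invar_inj_connected : m = 1%N -> forall a, bnd a = 0 -> a = 0.
Proof.
move=> m1; have [E0 _] := E_cocycle.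
pose F : {additive freeZ U -> A} := linext (fun x => - E 0 (x *~ s')).
suff FE : F \o bnd =1 idfun by move=> a bnd0; rewrite -[a]FE /= bnd0 raddf0.
have SK x : S (x *~ s') = x.
  rewrite -{1}[x]zmodn_val // -raddfMz SE -[RHS]zmodn_val //.
  apply/eqP; rewrite -subr_eq0 -raddfB zmodn_eq0 //.
  rewrite nEz mulrzz.
  have -> : m%:Z * s * (x%:Z * s') - x%:Z = m%:Z * ((s * s' - 1) * x%:Z).
    by rewrite m1; ring.
  by rewrite dvdz_mul // dvdz_mulr.
apply: E_ext => x u /=; rewrite bndE raddfB 2![F _]linext_gen opprK addrC.
rewrite mulrzDl -raddfMz SK E_add; last by rewrite m1.
by rewrite SK add0r addrAC subrr add0r.
Qed.

Section ModuloMovesByOne.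
Hypothesis m_gt1 : (1 < m)%N.
Let k0 : 'I_(m - 1) := Ordinal (etrans (subn_gt0 1 m) m_gt1).

(** In [Q] the moves 1 are killed, so an edge may be moved along them: its class
    depends only on its label and orbit, and it is additive along mZ/nZ. *)
Let Q := cok (linext (fun x => E x one_U)).
Let pi : {additive A -> Q} := to_cok _.

Lemma pi_one x : pi (E x one_U) = 0.
Proof. by apply/to_cok_eq0; exists (gen x); rewrite [LHS]linext_gen. Qed.

Lemma pi_E_orbit x y u : cls x = cls y -> pi (E x u) = pi (E y u).
Proof.
move=> /cls_eqP[v ->]; rewrite -[v]one_gen raddfMn.
elim: (v : nat) => [|i IHi]; first by rewrite mulr0n addr0.
rewrite IHi mulrSr addrA; move: (x + _) => z.
have /(congr1 pi) := E_square z one_U u.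
by rewrite !raddfD !pi_one add0r addr0.
Qed.

Lemma pi_E_add x (v w : U) : (m %| w)%N ->
  pi (E x (v + w)) = pi (E x v) + pi (E x w).
Proof.
move=> mw; rewrite E_add // raddfD.
by rewrite (pi_E_orbit (x := x + S v) (y := x)) ?cls_addS.
Qed.

Definition lift_divm (r : 'I_m) (h : Zmodn N) : Q :=
  pi (E (rep r) (zmodn n (m * h)%N)).

Lemma lift_divm_zmod_morphism r : zmod_morphism (lift_divm r).
Proof.
move=> g h; apply/eqP; rewrite eq_sym subr_eq /lift_divm -pi_E_add; last first.
  by rewrite dvd_zmodn PoszM dvdz_mulr.
rewrite -raddfD; apply/eqP; congr (pi (E _ _)); apply/eqP.
rewrite -subr_eq0 -raddfB zmodn_eq0 // nEz !PoszM -mulrDr -mulrBr.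
rewrite dvdz_mul // -zmodn_eq0 //; move: (g - h) (esym (subrK h g)) => k ->.
have zmodnBD a b c : zmodn N (a - (b + c)) = zmodn N a - (zmodn N b + zmodn N c).
  by rewrite raddfB raddfD.
by rewrite zmodnBD !zmodn_val // subrr.
Qed.
HB.instance Definition _ r := GRing.isZmodMorphism.Build (Zmodn N) Q
  (lift_divm r) (lift_divm_zmod_morphism r).

Definition classC (p : 'I_m * 'I_(m - 1)) : Q :=
  pi (E (rep p.1) (zmodn n p.2.+1)).

(** The class in [Q] of the edges with given invariants. *)
Definition psi (w : W) : Q :=
  linext classC w.1
  + \sum_r lift_divm r (w.2 r).

Lemma psi_zmod_morphism : zmod_morphism psi.
Proof.
move=> v w; rewrite /psi opprD [RHS]addrACA; congr (_ + _).
  exact: (raddfB (linext _)).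
by rewrite -sumrB; apply: eq_bigr => r _; rewrite !ffunE raddfB.
Qed.
HB.instance Definition _ := GRing.isZmodMorphism.Build W Q psi psi_zmod_morphism.

Lemma psi_unitC (r : 'I_m) j : (j < m)%N ->
  linext classC
    [ffun p : 'I_m * 'I_(m - 1) => ((p.1 == r) && (p.2.+1 == j))%:Z]
  = pi (E (rep r) (zmodn n j)).
Proof.
have [E0 _] := E_cocycle.
case: j => [|j] ltjm.
  rewrite (raddf0 (zmodn n)) E0 raddf0 /linext big1 // => p _.
  by rewrite ffunE andbF mulr0z.
have lt_j : (j < m - 1)%N by lia.
rewrite -[RHS]/(classC (r, Ordinal lt_j)) -(linext_gen classC).
by congr (linext _ _).
Qed.

Lemma psi_invar a : psi (invar a) = pi a.
Proof.
have [E0 _] := E_cocycle.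
move: a; apply: (E_ext (F := psi \o invar)) => x u /=.
have dvd_m_mul h : (m %| (zmodn n (m * h)%N : nat))%N.
  by rewrite dvd_zmodn PoszM dvdz_mulr.
have rx : cls (rep (cls x)) = cls x by rewrite cls_rep.
rewrite -(pi_E_orbit u rx).
rewrite invarE /psi psi_unitC ?ltn_pmod // (bigD1 (cls x)) //= ffunE eqxx.
rewrite big1 ?addr0; last first.
  by move=> r /negbTE rxr; rewrite ffunE rxr raddf0.
rewrite -[lift_divm _ _]/(pi _) -pi_E_add // -raddfD; congr (pi (E _ _)).
have lt_uN : (u %/ m < N)%N.
  by rewrite ltn_divLR // mulnC -nE -[X in (_ < X)%N](prednK n_gt0).
rewrite /divm (val_zmodn_small _ lt_uN) // -PoszD mulnC addnC -divn_eq.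
exact: zmodn_val.
Qed.

(** By [psi_invar] the cycle [a] is a combination [sum b x * E x 1] of moves 1.
    Its boundary vanishes, so [b] is constant on orbits; the invariant which
    counts the moves 1 in an orbit is then a positive multiple of [b]. *)
Lemma invar_inj_several a : bnd a = 0 -> invar a = 0 -> a = 0.
Proof.
move=> bnd0 invar0.
have /to_cok_eq0[b ab] : pi a = 0 by rewrite -psi_invar invar0 raddf0.
have bS x : b (x + S one_U) = b x.
  have := congr1 (fun c : freeZ U => c (x + S one_U)) bnd0.
  rewrite -ab raddf_sum sum_ffunE ffunE.
  under eq_bigr => y _ do
    rewrite raddfMz bndE ffunMzE !ffunE (inj_eq (addIr _)) eq_sym
      [x == y]eq_sym mulrzz mulrBl.
  rewrite sumrB.
  have sum_eq z : \sum_y (y == z)%:Z * b y = b z.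
    rewrite (bigD1 z) //= eqxx mul1r big1 ?addr0 // => y /negbTE->.
    by rewrite mul0r.
  by rewrite !sum_eq => /eqP; rewrite subr_eq0 => /eqP.
have b_cls x y : cls x = cls y -> b x = b y.
  move=> /cls_eqP[v ->]; rewrite -[v]one_gen raddfMn.
  elim: (v : nat) => [|i IHi]; first by rewrite mulr0n addr0.
  by rewrite mulrSr addrA bS.
have b0 x : b x = 0.
  have /(congr1 (fun w : W => w.1 (cls x, k0))) := invar0.
  rewrite -ab raddf_sum raddf_sum sum_ffunE ffunE.
  under eq_bigr => y _ do
    rewrite raddfMz invar_one // raddfMz ffunMzE ffunE xpair_eqE eqxx
      andbT mulrzz.
  rewrite (eq_bigr (fun y => if cls x == cls y then b x else 0)) => [|y _]; last first.
    by case: eqP => [/b_cls->|_]; rewrite ?mul1r ?mul0r.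
  rewrite -big_mkcond sumr_const => /eqP; rewrite mulrn_eq0 => /orP[|/eqP //].
  by rewrite (cardD1 x) unfold_in eqnE eqxx.
by rewrite -ab /= /linext big1 // => x _; rewrite b0 mulr0z.
Qed.

End ModuloMovesByOne.

Lemma invar_inj a : bnd a = 0 -> invar a = 0 -> a = 0.
Proof.
have [m1|m_neq1] := eqVneq m 1%N; last by apply: invar_inj_several; lia.
by move=> bnd0 _; apply: invar_inj_connected.
Qed.

Lemma cycle_invariants : exists invar : {additive A -> invariants m N},
  (forall a, bnd a = 0 -> invar a = 0 -> a = 0) /\
  (forall w, (exists2 a, bnd a = 0 & invar a = w) <-> forall r, disp r w = 0).
Proof.
exists invar; split=> [|w]; first exact: invar_inj.
by split=> [[a bnd0 <-] r|]; [apply: disp_cycle | apply: cycle_realize].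
Qed.

End EdgeInvariants.

(** * Linear Alexander quandles *)

Section Assembly.
Local Open Scope ring_scope.

Lemma disp_kernel_param (m N : nat) : (0 < m)%N -> (0 < N)%N ->
  exists theta : {additive ({ffun 'I_((m - 1) * m) -> int} *
      {ffun 'I_m -> Zmodn (gcdn m N)})%type -> invariants m N},
    injective theta /\
    forall w, (forall r, disp r w = 0) <-> exists p, theta p = w.
Proof.
move=> m_gt0 N_gt0.
have [alpha [v bezout]] := Bezoutz m N.
have alphaP : (N %| alpha * m%:Z - (gcdn m N)%:Z)%Z.
  have -> : (gcdn m N)%:Z = alpha * m + v * N by [].
  by rewrite opprD addNKr rpredN dvdz_mull.
have card_idx : #|{: 'I_m * 'I_(m - 1)}| = ((m - 1) * m)%N.
  by rewrite card_prod !card_ord mulnC.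
pose idx p := cast_ord card_idx (enum_rank p).
have idx_bij : bijective idx.
  exact: bij_comp (Bijective (cast_ordK _) (cast_ordKV _)) (enum_rank_bij _).
exact: disp_kernel_of_bezout alphaP idx_bij.
Qed.

Section LinearAlexanderHomology.
Variables (n : nat) (T : {additive Zmodn n -> Zmodn n}) (T_bij : bijective T).
Hypothesis n_gt0 : (0 < n)%N.
Let X := alexander T_bij.
Let S : {additive Zmodn n -> Zmodn n} := idfun \- T.

Lemma alexander_opS x u : alexander_op T x (x + u) = x + S u.
Proof.
by rewrite /alexander_op raddfD opprD addrACA [LHS]addrA [T x + _]addrC subrK.
Qed.

Variables (m N : nat) (s s' : int).
Hypotheses (nE : n = (m * N)%N)
  (SE : forall z, S (zmodn n z) = zmodn n (m%:Z * s * z))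
  (ss' : (N %| s * s' - 1)%Z).

Let m_gt0 : (0 < m)%N. Proof. by move: n_gt0; rewrite nE muln_gt0 => /andP[]. Qed.
Let block (r : 'I_m) : {set X} := [set y : X | cls n_gt0 nE y == r].

(** A right translation moves [y] by an element of the image of [S], so it
    preserves blocks; one of them is enough to go from [x] to any [x + S v]. *)
Lemma orbit_block (x : X) : orbit 'P (inner_group X) x = block (cls n_gt0 nE x).
Proof.
apply/eqP; rewrite eqEsubset; apply/andP; split.
  rewrite acts_sub_orbit ?inE // gen_subG; apply/subsetP => _ /imsetP[c _ ->].
  rewrite !inE; apply/subsetP => y; rewrite !inE /= apermE permE.
  have -> : qop y c = y + S ((c : Zmodn n) - y).
    by rewrite -alexander_opS addrC subrK.
  by rewrite (cls_addS _ _ SE).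
apply/subsetP => y; rewrite inE => /eqP/esym /(cls_eqP SE ss')[v ->].
rewrite -alexander_opS.
have -> : alexander_op T x (x + v) = aperm x (rtrans (x + v : X)).
  by rewrite apermE permE.
by apply: mem_orbit; rewrite mem_gen ?imset_f.
Qed.

Lemma card_orbits : #|quandle_orbits X| = m.
Proof.
have -> : quandle_orbits X = [set block r | r : 'I_m].
  apply/setP => B; apply/imsetP/imsetP => [[x _ ->] | [r _ ->]].
    by exists (cls n_gt0 nE x) => //; rewrite orbit_block.
  by exists (rep n r : X); rewrite ?orbit_block ?cls_rep.
rewrite card_imset ?card_ord // => r r' /setP/(_ (rep n r)).
by rewrite !inE cls_rep eqxx => /esym/eqP.
Qed.

Let E (x u : Zmodn n) : edge_group X := edge (x : X) (x + u : Zmodn n).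

Lemma alexander_op_shift x u v :
  alexander_op T (x + u) (x + v) = x + S v + (u - S u).
Proof.
rewrite -[v in LHS](subrKC u) addrA alexander_opS raddfB.
by rewrite addrACA addrA.
Qed.

(** With labels [u = y - x], the boundary relation of edges becomes the cocycle
    relation for [S]. *)
Lemma edge_cocycle : cocycle S E.
Proof.
split=> [x|x u v]; first by rewrite /E addr0 edgexx.
have := edge_rel (x : X) (x + u : Zmodn n) (x + v : Zmodn n).
rewrite [qop _ _]alexander_opS [qop _ _]alexander_opS [qop _ _]alexander_op_shift /E.
by rewrite [x + S u + (v - S u)]addrACA subrr addr0.
Qed.

Lemma edge_lift_shift (V : zmodType) (f : Zmodn n -> Zmodn n -> V) :
  cocycle S f ->
  {F : {additive edge_group X -> V} | forall x u, F (E x u) = f x u}.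
Proof.
case=> f0 fS; pose g (x y : X) := f x ((y : Zmodn n) - x).
have [|x y z|F FE] := @edge_lift X V g; rewrite ?/g.
- by move=> x; rewrite subrr.
- pose u : Zmodn n := (y : Zmodn n) - x; pose v : Zmodn n := (z : Zmodn n) - x.
  have [-> ->] : y = x + u :> Zmodn n /\ z = x + v :> Zmodn n.
    by rewrite /u /v !(addrC (x : Zmodn n)) !subrK.
  rewrite [qop _ _]alexander_opS [qop _ _]alexander_opS [qop _ _]alexander_op_shift.
  have addKl (a b : Zmodn n) : a + b - a = b by rewrite addrC addKr.
  by rewrite !addKl opprD addrACA subrr add0r fS.
by exists F => x u; rewrite FE /g addrC addKr.
Qed.

Lemma H2_alexander : zmod_isog (quandle_H2 X)
  ({ffun 'I_((m - 1) * m) -> int} * {ffun 'I_m -> Zmodn (gcdn m N)})%type.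
Proof.
have [bnd bndK bndE] := edge_bnd X.
have bndE' x u : bnd (E x u) = gen x - gen (x + S u).
  by rewrite bndE /= alexander_opS.
have E_sum a : exists c : freeZ (Zmodn n * Zmodn n)%type,
    a = \sum_p E p.1 p.2 *~ c p.
  have [c ->] := edge_sum a.
  exists [ffun p => c (p.1 : X, p.1 + p.2 : Zmodn n)].
  pose shift (p : Zmodn n * Zmodn n) : X * X := (p.1, p.1 + p.2).
  pose unshift (p : X * X) : Zmodn n * Zmodn n := (p.1, (p.2 : Zmodn n) - p.1).
  rewrite (reindex shift); first by apply: eq_bigr => p _; rewrite ffunE.
  exists unshift => -[x y] _; rewrite /shift /unshift /=; congr pair.
    by rewrite addrC addKr.
  by rewrite addrC subrK.
have [invar [invar_inj invar_im]] := cycle_invariants n_gt0 nE SE ss' edge_cocycle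
  E_sum edge_lift_shift bndE'.
have [|theta [theta_inj theta_im]] := disp_kernel_param m_gt0 (N := N).
  by move: n_gt0; rewrite nE muln_gt0 => /andP[].
apply: (homology_isog bndK invar_inj theta_inj) => w.
exact: iff_trans (invar_im w) (theta_im w).
Qed.

End LinearAlexanderHomology.

(** [S] is multiplication by [k = S 1]; then [m = gcd (k, n)], and [s = k / m] is
    inverted modulo [n / m] by the coefficient of [k] in a relation
    [s' * k + v * n = m]. *)
Lemma slope_factor (n : nat) (S : {additive Zmodn n -> Zmodn n}) : (0 < n)%N ->
  exists m N s s', [/\ n = (m * N)%N,
    forall z, S (zmodn n z) = zmodn n (m%:Z * s * z) & (N%:Z %| s * s' - 1)%Z].
Proof.
move=> n_gt0; pose k : nat := S (zmodn n 1).
have SE z : S (zmodn n z) = zmodn n (k%:Z * z).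
  have -> : zmodn n z = zmodn n 1 *~ z by rewrite -raddfMz /= intz.
  by rewrite raddfMz zmodnMz // mulrC.
pose m := gcdn k n; have m_gt0 : (0 < m)%N by rewrite gcdn_gt0 n_gt0 orbT.
have kE : k%:Z = m%:Z * (k %/ m)%N by rewrite -PoszM mulnC divnK ?dvdn_gcdl.
have nE : n = (m * (n %/ m))%N by rewrite mulnC divnK ?dvdn_gcdr.
have nEz : n%:Z = m%:Z * (n %/ m)%N by rewrite -PoszM -nE.
have [s' [v bezout]] := Bezoutz k n.
exists m, (n %/ m)%N, (k %/ m)%N%:Z, s'; split=> [||] //.
  by move=> z; rewrite SE kE.
have -> : (k %/ m)%N%:Z * s' - 1 = (n %/ m)%N%:Z * - v.
  have m0 : m%:Z != 0 by rewrite eqz_nat -lt0n.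
  apply: (mulfI m0); rewrite mulrBr !mulrA -kE -nEz mulr1.
  rewrite -[m%:Z]/(gcdz k n) -bezout; ring.
by rewrite dvdz_mulr.
Qed.

End Assembly.

Theorem theorem3 (n : nat) (n_gt0 : (0 < n)%N)
    (T : {additive Zmodn n -> Zmodn n}) (T_bij : bijective T) :
  let X := alexander T_bij in
  let m := #|quandle_orbits X| in
  let d := gcdn m (n %/ m) in
  zmod_isog (quandle_H2 X)
    ({ffun 'I_((m - 1) * m) -> int} * {ffun 'I_m -> Zmodn d})%type.
Proof.
move=> X m d.
have [q [N [s [s' [nE SE ss']]]]] := slope_factor (idfun \- T)%R n_gt0.
have mq : m = q by apply: (card_orbits T_bij n_gt0 nE SE ss').
have -> : d = gcdn m N.
  by rewrite /d {2}mq nE mulKn // lt0n; apply/eqP => q0; move: n_gt0; rewrite nE q0.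
rewrite mq; exact: (H2_alexander T_bij n_gt0 nE SE ss').
Qed.
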